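(* The folded cubes $\mathrm{FQ}_1$, $\mathrm{FQ}_2$ and $\mathrm{FQ}_3$ are $[1,0,6]$-cycle regular. The folded cubes $\mathrm{FQ}_4$ and $\mathrm{FQ}_6$ are $[1,36,6]$-cycle regular and $[1,200,6]$-cycle regular, respectively. For every integer $n\ge 1$ with $n\notin\{1,2,3,4,6\}$, the folded cube $\mathrm{FQ}_n$ is $[1,4(n-2)(n-1),6]$-cycle regular.
   Context: For $n\ge 1$, the folded cube $\mathrm{FQ}_n$ is the simple graph with vertex set $\{0,1\}^{n-1}$ in which two distinct vertices are adjacent if and only if they differ in exactly one coordinate or one is the coordinatewise complement of the other (equivalently, $\mathrm{FQ}_n$ is obtained from the $n$-dimensional hypercube by identifying antipodal vertices). For integers $l,\lambda,m$, a simple graph is $[l,\lambda,m]$-cycle regular if every path on $l+1$ vertices belongs to exactly $\lambda$ different cycles of length $m$. *)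

(* Defs.v *)
From HB Require Import structures.
From mathcomp Require Import all_boot.
Set Implicit Arguments.
Unset Strict Implicit.
Unset Printing Implicit Defensive.

Record sgraph := SGraph {
  vertex :> finType;
  adj : rel vertex;
  adj_sym : symmetric adj;
  adj_irrefl : irreflexive adj
}.

Section CycleRegularity.
Variable G : sgraph.

(* A subgraph is its vertex set together with its set of edges, an edge being
   an unordered pair of vertices. Counting cycles as subgraphs (and not as
   vertex sequences) identifies rotations and reversals of the same cycle. *)
Definition subgraph : Type := ({set G} * {set {set G}})%type.

Definition in_subgraph (A B : subgraph) : bool :=
  (A.1 \subset B.1) && (A.2 \subset B.2).

Definition path_graph (s : seq G) : subgraph :=
  ([set x in s], [set [set u.1; u.2] | u in zip s (behead s)]).

(* For duplicate-free c, next c x is the cyclic successor of x in c. *)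
Definition cycle_graph (c : seq G) : subgraph :=
  ([set x in c], [set [set x; next c x] | x in c]).

Definition is_path (s : seq G) : bool := uniq s && sorted (@adj G) s.

Definition is_cycle (m : nat) (C : subgraph) : bool :=
  (3 <= m) &&
  [exists c : m.-tuple G,
     [&& uniq c, cycle (@adj G) c & C == cycle_graph c]].

Definition cycle_regular (l lambda m : nat) : Prop :=
  forall s : l.+1.-tuple G, is_path s ->
    #|[set C : subgraph | is_cycle m C && in_subgraph (path_graph s) C]|
      = lambda.

End CycleRegularity.

Definition FQ_vertex (n : nat) : finType := {ffun 'I_n.-1 -> bool}.

(* The condition x != y only matters for n = 1, where the unique vertex is its
   own complement. *)
Definition FQ_adj (n : nat) : rel (FQ_vertex n) :=
  fun x y => (x != y) &&
    ((#|[set i | x i != y i]| == 1) || (y == [ffun i => ~~ x i])).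

Lemma FQ_adj_sym (n : nat) : symmetric (@FQ_adj n).
Proof.
move=> x y; rewrite /FQ_adj eq_sym; congr (_ && (_ || _)).
  by congr (#|pred_of_set _| == 1); apply/setP=> i; rewrite !inE eq_sym.
by apply/eqP/eqP=> ->; apply/ffunP=> i; rewrite !ffunE negbK.
Qed.

Lemma FQ_adj_irrefl (n : nat) : irreflexive (@FQ_adj n).
Proof. by move=> x; rewrite /FQ_adj eqxx. Qed.

(* Meaningful for n >= 1 only. *)
Definition FQ (n : nat) : sgraph :=
  SGraph (@FQ_adj_sym n) (@FQ_adj_irrefl n).

(* Main.v *)
Require Import Defs.
From mathcomp Require Import all_boot.

(** FQ_n is the Cayley graph of (Z/2)^(n-1) on n generators whose only relation
is that all of them sum to zero. A closed walk of length 6 from a given vertex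
is thus a word of 6 generators whose multiplicities all have the same parity,
and for n >= 4 the walk is a cycle iff cyclically neighbouring letters differ.
With the first letter prescribed, the words with even multiplicities arise from
the 4 perfect matchings of the positions 0, ..., 5 that match no neighbouring
positions, and (n-1)(n-2) choices for the two other letters. Words with odd
multiplicities use every generator, and exist only for n = 4, where one letter
occupies alternate positions (12 words), and for n = 6, where they are the
orderings of the generators (120 words). *)

Set Implicit Arguments.
Unset Strict Implicit.
Unset Printing Implicit Defensive.

(** * Cycles through an edge, counted as vertex sequences *)

Lemma set2_eq (T : finType) (a b c d : T) :
  [set a; b] = [set c; d] -> (a = c /\ b = d) \/ (a = d /\ b = c).
Proof.
move=> /setP E.
have := E a; rewrite !inE eqxx /= => /esym/orP[]/eqP Ea; subst a.
  have := E b; rewrite !inE eqxx orbT => /esym/orP[]/eqP Eb; subst b; last by left.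
  by left; have := E d; rewrite !inE eqxx orbT orbb => /eqP ->.
have := E b; rewrite !inE eqxx orbT => /esym/orP[]/eqP Eb; subst b; first by right.
by right; have := E c; rewrite !inE eqxx orbb => /eqP ->.
Qed.

Lemma next_next_neq (T : eqType) (c : seq T) (u : T) :
  uniq c -> 2 < size c -> u \in c -> next c (next c u) != u.
Proof.
move=> Uc sz /rot_to[i s E].
rewrite -!(next_rot i Uc) E; move: Uc sz.
rewrite -(rot_uniq i) -(size_rot i) E.
case: s {E} => [|a [|b s]] //= /andP[nu _] _.
move: nu; rewrite !inE !negb_or => /and3P[nua nub _].
by rewrite !eqxx [a == u]eq_sym (negPf nua) eq_sym.
Qed.

Section CyclesThroughEdge.
Variable G : sgraph.

Lemma cycle_graph_rot i (c : seq G) :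
  uniq c -> cycle_graph (rot i c) = cycle_graph c.
Proof.
move=> Uc; congr (_, _); first by apply/setP=> z; rewrite !inE mem_rot.
apply/setP=> e; apply/imsetP/imsetP=> -[z]; rewrite ?mem_rot => zc ->;
  by exists z; rewrite ?mem_rot // next_rot.
Qed.

Lemma cycle_graph_rev (c : seq G) :
  uniq c -> cycle_graph (rev c) = cycle_graph c.
Proof.
move=> Uc; congr (_, _); first by apply/setP=> z; rewrite !inE mem_rev.
apply/setP=> e; apply/imsetP/imsetP=> -[z]; rewrite ?mem_rev => zc ->.
  exists (prev c z); first by rewrite mem_prev.
  by rewrite next_rev // next_prev // setUC.
exists (next c z); first by rewrite mem_rev mem_next.
by rewrite next_rev // prev_next // setUC.
Qed.

(** The common first step from [x] to [y] fixes the direction. Where the successors of [u] agree on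
    [v], the edge by which the first cycle leaves [v] also leaves [v] in the second, or is the edge
    by which the second enters [v] from [u]; the latter would lead back to [u]. *)
Lemma cycle_graph_inj (x y : G) (s t : seq G) :
    uniq [:: x, y & s] -> uniq [:: x, y & t] -> size s = size t -> 0 < size s ->
  cycle_graph [:: x, y & s] = cycle_graph [:: x, y & t] -> s = t.
Proof.
set c := [:: x, y & s]; set c' := [:: x, y & t] => Us Ut sz s0 [_ /setP E].
have step u : u \in c -> next c u = next c' u ->
    next c (next c u) = next c' (next c u).
  move=> uc nu; set v := next c u in nu *.
  have vc : v \in c by rewrite mem_next.
  have /imsetP[z zc /set2_eq[[-> ->] //|[vz nz]]] :
      [set v; next c v] \in (cycle_graph c').2.
    by rewrite -E; apply/imsetP; exists v.
  have := next_next_neq Us _ uc; rewrite -/v !ltnS => /(_ s0)/eqP[].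
  by apply: (can_inj (prev_next Ut)); rewrite -nu nz vz.
have trajE k u : u \in c -> next c u = next c' u ->
    traject (next c) u k = traject (next c') u k.
  elim: k u => // k IH u uc nu; rewrite !trajectS -nu IH ?mem_next //.
  exact: step.
have nx : next c x = next c' x by rewrite /= eqxx.
have : fpath (next c) x (y :: s).
  by have := cycle_next Us; rewrite /= rcons_path => /and3P[-> -> _].
have : fpath (next c') x (y :: t).
  by have := cycle_next Ut; rewrite /= rcons_path => /and3P[-> -> _].
case/fpathP=> k Ek /fpathP[l El].
have Ekl : l = k.
  by rewrite -(size_traject (next c) (next c x) l) -El /= sz -/(size (y :: t)) Ek size_traject.
have : y :: s = y :: t.
  by rewrite Ek El Ekl trajE ?mem_next ?mem_head ?nx // -nx step ?mem_head.
by case.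
Qed.

(** Among the rotations and reversals of a cycle containing the edge, exactly one starts with [x],
    [y]. *)
Lemma card_cycles_through_edge (m : nat) (x y : G) :
  #|[set C : subgraph G | is_cycle m.+3 C && in_subgraph (path_graph [:: x; y]) C]|
  = #|[set t : m.+1.-tuple G |
        uniq [:: x, y & t] && cycle (@adj G) [:: x, y & t]]|.
Proof.
rewrite -(card_in_imset (f := fun t : m.+1.-tuple G => cycle_graph [:: x, y & t])); last first.
  move=> s t; rewrite !inE => /andP[Us _] /andP[Ut _] /cycle_graph_inj E.
  by apply/val_inj/E; rewrite ?size_tuple.
apply: eq_card => C; rewrite !inE; apply/idP/imsetP; last first.
  case=> t; rewrite inE => /andP[Ut Ct] ->; apply/andP; split.
    rewrite /is_cycle /=; apply/existsP; exists [tuple of [:: x, y & t]].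
    by rewrite Ut Ct eqxx.
  apply/andP; split; apply/subsetP => z.
    by rewrite !inE; case: eqP => //= _ ->.
  case/imsetP=> u; rewrite inE => /eqP -> ->.
  by apply/imsetP; exists x; rewrite ?mem_head //= eqxx.
case/andP=> /andP[_ /existsP[c /and3P[Uc Cc /eqP->{C}]]] /andP[_ /subsetP sub].
(* Once the cycle is oriented so that [y] follows [x], a rotation brings [x] to the front. A
   sequence traversing the edge backwards is reversed. *)
suff [s [Us Cs Es] [xs ny sz]] : exists2 s : seq G,
    [/\ uniq s, cycle (@adj G) s & cycle_graph s = cycle_graph c]
  & [/\ x \in s, next s x = y & size s = m.+3].
  have [i s' Er] := rot_to xs; rewrite -(size_rot i) Er in sz.
  rewrite -(next_rot i Us) in ny; rewrite -(cycle_graph_rot i Us) in Es.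
  move: Us Cs; rewrite -(rot_uniq i) -(rot_cycle i) -Es.
  rewrite Er in ny *.
  case: s' {Er} sz ny => [|z t] //= [sz]; rewrite eqxx => -> Us Cs.
  by exists (tcast sz (in_tuple t)); rewrite ?inE ?val_tcast //; apply/andP.
have /sub/imsetP[z zc /set2_eq[[xz yz]|[xz yz]]] :
    [set x; y] \in (path_graph [:: x; y]).2.
  by apply/imsetP; exists (x, y); rewrite ?inE.
- by exists c; split; rewrite ?xz -?yz ?size_tuple.
- exists (rev c); split; rewrite ?rev_uniq ?cycle_graph_rev ?size_rev ?size_tuple //.
  + by rewrite rev_cycle (eq_cycle (e' := @adj G)) // => u v; rewrite adj_sym.
  + by rewrite mem_rev xz mem_next.
  + by rewrite next_rev // xz prev_next.
Qed.
End CyclesThroughEdge.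

(** * Hexagons in the folded cube as words of generators *)

Lemma tuple4P (T : Type) (t : 4.-tuple T) :
  exists p q r s, t = [tuple p; q; r; s].
Proof.
case: t => [[|p [|q [|r [|s []]]]] //= t4].
by exists p, q, r, s; apply: val_inj.
Qed.

Lemma tuple5P (T : Type) (t : 5.-tuple T) :
  exists p q r s u, t = [tuple p; q; r; s; u].
Proof.
case: t => [[|p [|q [|r [|s [|u []]]]]] //= t5].
by exists p, q, r, s, u; apply: val_inj.
Qed.

Section Words.
Variable m : nat.
Local Notation L := (option 'I_m).
Local Notation V := (FQ_vertex m.+1).
Implicit Types (d : L) (w : seq L) (x y : V).

(* The letter [Some i] changes coordinate [i], the letter [None] complements. *)
Definition flip x d : V := [ffun i => x i (+) (d \in [:: None; Some i])].

Definition same_parity w :=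
  [forall d, odd (count_mem d w) == odd (count_mem None w)].

Lemma foldl_flipE w x i :
  foldl flip x w i =
    x i (+) (odd (count_mem None w) (+) odd (count_mem (Some i) w)).
Proof.
elim: w x => [|d w IH] x /=; first by rewrite addbF.
rewrite IH ffunE !inE !oddD !oddb.
case: d => [j|]; rewrite ?eqxx ?(inj_eq Some_inj) /= -addbA.
  by congr (_ (+) _); rewrite addbCA.
by rewrite addTb addNb.
Qed.

(** Coordinate [i] changes exactly when the multiplicities of [None] and [Some i] differ in
    parity. *)
Lemma foldl_flip_eq w x : (foldl flip x w == x) = same_parity w.
Proof.
apply/eqP/forallP => [E [i|] //|E]; last first.
  apply/ffunP=> i; rewrite foldl_flipE.
  by rewrite (eqP (E (Some i))) addbb addbF.
have /ffunP/(_ i) := E; rewrite foldl_flipE.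
by case: (x i) (odd _) (odd _) => [] [] [].
Qed.

Lemma flipK d x : flip (flip x d) d = x.
Proof. by apply/ffunP=> i; rewrite !ffunE addbK. Qed.

(** One odd multiplicity makes all of them odd, so each of the [m + 1] letters would occur, too many
    for the length. *)
Lemma same_parity_short w :
  size w <= m -> same_parity w -> forall d, ~~ odd (count_mem d w).
Proof.
move=> sw /forallP E d; apply/negP=> od.
have oddE e : odd (count_mem e w).
  by rewrite (eqP (E e)) -(eqP (E d)).
have sub : {subset enum {: L} <= w}.
  by move=> e _; rewrite -has_pred1 has_count odd_gt0.
have := uniq_leq_size (enum_uniq _) sub.
by rewrite -cardE card_option card_ord leqNgt ltnS sw.
Qed.

Lemma FQ_adjP (x y : FQ m.+1) : 2 <= m ->
  reflect (exists d, y = flip x d) (adj x y).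
Proof.
move=> m2; rewrite /= /FQ_adj.
have flip_neq d : x != flip x d.
  apply/eqP=> E; have /= := foldl_flip_eq [:: d] x; rewrite -E eqxx.
  by move/esym/(@same_parity_short [:: d] (ltnW m2))/(_ d); rewrite /= eqxx.
apply: (iffP andP) => [[_ /orP[/cards1P[i /setP E]|/eqP->]]|[d ->]].
- exists (Some i); apply/ffunP=> j; have := E j; rewrite !inE !ffunE !inE /=.
  by rewrite (inj_eq (@Some_inj _)) [i == j]eq_sym => <-; case: (x j) (y j) => [] [].
- by exists None; apply/ffunP=> j; rewrite !ffunE !inE addbT.
split=> //; case: d => [i|]; apply/orP; [left|right].
  apply/cards1P; exists i; apply/setP=> j; rewrite !inE !ffunE !inE /=.
  by rewrite (inj_eq (@Some_inj _)) [j == i]eq_sym; case: (x j) (i == j) => [] [].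
by apply/eqP/ffunP=> j; rewrite !ffunE !inE addbT.
Qed.

Hypothesis m3 : 3 <= m.

Lemma flip1 x a : (flip x a == x) = false.
Proof.
rewrite (foldl_flip_eq [:: a] x); apply/negP.
by move=> /(@same_parity_short [:: a] (ltnW (ltnW m3)))/(_ a); rewrite /= eqxx.
Qed.

Lemma flip2 x a b : (flip (flip x a) b == x) = (a == b).
Proof.
rewrite (foldl_flip_eq [:: a; b] x); apply/idP/eqP => [|->].
  move=> /(@same_parity_short [:: a; b] (ltnW m3))/(_ a).
  by rewrite /= eqxx eq_sym; case: eqP.
by apply/forallP=> d /=; rewrite !addn0 !addnn !odd_double.
Qed.

Lemma flip3 x a b c : (flip (flip (flip x a) b) c == x) = false.
Proof.
rewrite (foldl_flip_eq [:: a; b; c] x); apply/negP => /(@same_parity_short [:: a; b; c] m3) H.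
move: (H a) (H b) (H c); rewrite /= !eqxx ![_ == a]eq_sym ![_ == b]eq_sym.
by do !case: (_ == _).
Qed.

Lemma flip_inj x : injective (flip x).
Proof.
move=> a b E; apply/eqP; rewrite -(flip2 x); rewrite E; exact/eqP/flipK.
Qed.

(** Vertices one or three steps apart are joined by a word of odd length at most 3, whose
    multiplicities cannot all be even. Vertices two steps apart coincide iff the two letters between
    them do. *)
Lemma uniq_hexagon a b c d e f x0 x1 x2 x3 x4 x5 :
    x1 = flip x0 a -> x2 = flip x1 b -> x3 = flip x2 c -> x4 = flip x3 d ->
    x5 = flip x4 e -> x0 = flip x5 f ->
  uniq [:: x0; x1; x2; x3; x4; x5] =
    cycle (fun p q => p != q) [:: a; b; c; d; e; f].
Proof.
move=> E1 E2 E3 E4 E5 E0.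
have n01 : (x0 == x1) = false by rewrite E1 eq_sym flip1.
have n12 : (x1 == x2) = false by rewrite E2 eq_sym flip1.
have n23 : (x2 == x3) = false by rewrite E3 eq_sym flip1.
have n34 : (x3 == x4) = false by rewrite E4 eq_sym flip1.
have n45 : (x4 == x5) = false by rewrite E5 eq_sym flip1.
have n05 : (x0 == x5) = false by rewrite E0 flip1.
have n02 : (x0 == x2) = (a == b) by rewrite E2 E1 eq_sym flip2.
have n13 : (x1 == x3) = (b == c) by rewrite E3 E2 eq_sym flip2.
have n24 : (x2 == x4) = (c == d) by rewrite E4 E3 eq_sym flip2.
have n35 : (x3 == x5) = (d == e) by rewrite E5 E4 eq_sym flip2.
have n04 : (x0 == x4) = (e == f) by rewrite E0 E5 flip2.
have n15 : (x1 == x5) = (f == a) by rewrite E1 E0 flip2.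
have n03 : (x0 == x3) = false by rewrite E3 E2 E1 eq_sym flip3.
have n14 : (x1 == x4) = false by rewrite E4 E3 E2 eq_sym flip3.
have n25 : (x2 == x5) = false by rewrite E5 E4 E3 eq_sym flip3.
rewrite /= !inE n01 n12 n23 n34 n45 n05 n02 n13 n24 n35 n04 n15 n03 n14 n25.
by do !case: (_ == _).
Qed.

Definition good_words (a : L) := [set w : 5.-tuple L |
  same_parity (a :: w) && cycle (fun p q => p != q) (a :: w)].

Lemma card_hexagons (x : FQ m.+1) a :
  #|[set t : 4.-tuple (FQ m.+1) |
      uniq [:: x, flip x a & t] && cycle (@adj (FQ m.+1)) [:: x, flip x a & t]]|
  = #|good_words a|.
Proof.
have adjP u v := @FQ_adjP u v (ltnW m3).
have adj_flip u d : @adj (FQ m.+1) u (flip u d) by apply/adjP; exists d.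
(* [z k w] is the vertex reached after [a] and [k] letters of [w]; [g] leaves out the prescribed
   [z 0 w] and the final [z 5 w], which is [x] for a good word. *)
pose z k (w : seq L) : FQ m.+1 := foldl flip (flip x a) (take k w).
pose g (w : 5.-tuple L) := [tuple z 1 w; z 2 w; z 3 w; z 4 w].
have closing b c d e f : same_parity [:: a; b; c; d; e; f] ->
    x = flip (flip (flip (flip (flip (flip x a) b) c) d) e) f.
  by rewrite -(foldl_flip_eq _ x) => /eqP.
rewrite -(card_in_imset (f := g)).
  apply: eq_card => t; rewrite inE; apply/idP/imsetP.
    have [p [q [r [s ->]]]] := tuple4P t; rewrite [cycle _ _]/=.
    case/andP=> U /and5P[_ /adjP[b Eb] /adjP[c Ec] /adjP[d Ed]].
    case/and3P=> /adjP[e Ee] /adjP[f Ef] _.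
    exists [tuple b; c; d; e; f]; last first.
      by apply: val_inj; rewrite /= /z /= -Eb -Ec -Ed -Ee.
    rewrite inE -(foldl_flip_eq _ x) /= -Eb -Ec -Ed -Ee -Ef eqxx /=.
    by move: U; rewrite (uniq_hexagon (erefl _) Eb Ec Ed Ee Ef).
  case=> w; have [b [c [d [e [f ->]]]]] := tuple5P w.
  rewrite inE => /andP[/closing E cyc] ->.
  apply/andP; split.
    by move: cyc; rewrite -(uniq_hexagon (erefl _) (erefl _) (erefl _) (erefl _) (erefl _) E).
  do 5!(apply/andP; split; first exact: adj_flip).
  by rewrite /= andbT {1}E; apply: adj_flip.
move=> w w'; have [b [c [d [e [f ->]]]]] := tuple5P w.
have [b' [c' [d' [e' [f' ->]]]]] := tuple5P w'.
rewrite !inE => /andP[/closing H _] /andP[/closing H' _] [].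
(* Consecutive vertices determine the letters one by one; the last letter comes from the return to
   [x]. *)
rewrite /z /= => /flip_inj Eb; rewrite -{}Eb in H' * => /flip_inj Ec.
rewrite -{}Ec in H' * => /flip_inj Ed; rewrite -{}Ed in H' * => /flip_inj Ee.
rewrite -{}Ee in H' *; move: H'; rewrite {1}H => /flip_inj ->.
by apply: val_inj.
Qed.
End Words.

(** * Counting words by the parity of their multiplicities *)

Section CountingWords.
Variable T : finType.
Implicit Types (a b c d e f : T).
Local Notation distinct_neighbours := (cycle (fun p q : T => p != q)).

Definition parity_words p a := [set w : 5.-tuple T |
  [forall x, odd (count_mem x (a :: w)) == p] && distinct_neighbours (a :: w)].

Lemma card_uniq_cons k a :
  #|[set t : k.-tuple T | uniq (a :: t)]| = #|T|.-1 ^_ k.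
Proof.
rewrite -(cardC1 a) -(card_uniq_tuples k (predC1 a)); apply: eq_card => t.
by rewrite !inE /= -has_pred1 -all_predC.
Qed.

(* Neighbouring letters differ, so a letter occurs at most three times, and
   three times only at alternate positions. *)
Lemma parity_word_cases p a b c d e f :
    (forall x, odd (count_mem x [:: a; b; c; d; e; f]) = p) ->
    distinct_neighbours [:: a; b; c; d; e; f] ->
  if p then
    [|| uniq [:: a; b; c; d; e; f], (a == c) && (a == e) | (b == d) && (b == f)]
  else
    [|| [&& a == d, b == e & c == f], [&& a == d, b == f & c == e],
        [&& a == c, b == e & d == f] | [&& a == e, b == d & c == f]].
Proof.
move=> H /and5P[ab bc cd de /and3P[ef fa _]].
(* The parities are Boolean functions of the nine comparisons between non-neighbouring letters;
   [excl] supplies the transitivity that the case check needs. *)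
have excl (x y z : T) : y != z -> ~~ ((x == y) && (x == z)).
  by apply: contraNN => /andP[/eqP<- /eqP<-].
move: (excl a _ _ cd) (excl b _ _ de) (excl c _ _ ef).
move: (excl d _ _ ab) (excl e _ _ ab) (excl f _ _ bc).
move: (H a) (H b) (H c) (H d) (H e) (H f).
rewrite /= !inE !eqxx ?[b == a]eq_sym ?[c == a]eq_sym ?[d == a]eq_sym.
rewrite ?[e == a]eq_sym ?[c == b]eq_sym ?[d == b]eq_sym ?[e == b]eq_sym.
rewrite ?[f == b]eq_sym ?[d == c]eq_sym ?[e == c]eq_sym ?[f == c]eq_sym.
rewrite ?[e == d]eq_sym ?[f == d]eq_sym ?[f == e]eq_sym ?[a == f]eq_sym.
rewrite (negPf ab) (negPf bc) (negPf cd) (negPf de) (negPf ef) (negPf fa).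
clear; case: p; case: (a == c); case: (a == d); case: (a == e); case: (b == d);
  case: (b == e); case: (b == f); case: (c == e); case: (c == f);
  by case: (d == f).
Qed.

(* The four perfect matchings of the hexagon's positions without an edge
   between neighbouring positions; [a] sits at position 0. *)
Definition even_pattern a (k : bool * bool) (t : 2.-tuple T) : 5.-tuple T :=
  let b := nth a t 0 in let c := nth a t 1 in
  match k with
  | (false, false) => [tuple b; c; a; b; c]
  | (false, true) => [tuple b; c; a; c; b]
  | (true, false) => [tuple b; a; c; b; c]
  | (true, true) => [tuple b; c; b; a; c]
  end.

(** The free letters form an ordered pair of distinct letters other than [a], counted by a falling
    factorial. As the three letters are distinct, a word determines its matching. *)
Lemma card_even_words a :
  #|parity_words false a| = 4 * (#|T|.-1 * #|T|.-2).
Proof.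
have -> : #|T|.-1 * #|T|.-2 = #|T|.-1 ^_ 2 by rewrite ffactnS ffactn1.
rewrite -(card_uniq_cons 2 a); set S := [set t | _].
transitivity #|setX [set: bool * bool] S|; last first.
  by rewrite cardsX cardsT card_prod card_bool.
rewrite -(card_in_imset (f := fun u => even_pattern a u.1 u.2)).
  apply: eq_card => w; rewrite inE; apply/andP/imsetP => [[/forallP H]|].
    have {H} := fun x => eqP (H x); have [b [c [d [e [f ->]]]]] := tuple5P w.
    move=> H D; have := parity_word_cases H D.
    have mk k x y : uniq [:: a; x; y] ->
      (k, [tuple x; y]) \in setX [set: bool * bool] S.
      by rewrite !inE.
    move: D => /[swap]; case/or4P=> /and3P[/eqP<- /eqP<- /eqP<-] /=;
      rewrite ![_ == a]eq_sym => D.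
    - exists ((false, false), [tuple b; c]); last exact: val_inj.
      by apply: mk; rewrite /= !inE; move: D; do 3!case: (_ == _).
    - exists ((false, true), [tuple b; c]); last exact: val_inj.
      by apply: mk; rewrite /= !inE; move: D; do 3!case: (_ == _).
    (* Position 2 carries [a] here, so the second free letter is [d]. *)
    - exists ((true, false), [tuple b; d]); last exact: val_inj.
      by apply: mk; rewrite /= !inE; move: D; do 3!case: (_ == _).
    - exists ((true, true), [tuple b; c]); last exact: val_inj.
      by apply: mk; rewrite /= !inE; move: D; rewrite [c == b]eq_sym; do 3!case: (_ == _).
  case=> [[k [[|b [|c []]] //= t2]]]; rewrite !inE /= !inE negb_or !andbT.
  move=> /andP[/andP[ab ac] bc] ->; split; last first.
    case: k => [[] []]; rewrite /even_pattern /=;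
    by rewrite ?[b == a]eq_sym ?[c == a]eq_sym ?[c == b]eq_sym ab ac bc.
  apply/forallP=> x; case: k => [[] []]; rewrite /even_pattern /=;
  by case: (a == x); case: (b == x); case: (c == x).
move=> [k [[|b [|c []]] //= t2]] [l [[|b' [|c' []]] //= t2']].
rewrite !inE /= !inE !negb_or !andbT => /andP[/andP[ab ac] bc] /andP[/andP[ab' ac'] bc'].
case: k l => [[] []] [[] []]; rewrite /even_pattern /= => -[] *;
  clear S; subst;
  first [by congr (_, _); apply: val_inj
        | by move: ab ac bc ab' ac' bc'; rewrite ?eqxx ?andbF].
Qed.

Lemma card_leq_cover (s : seq T) : (forall x, x \in s) -> #|T| <= size s.
Proof.
by move=> cov; rewrite cardE; apply: (uniq_leq_size (enum_uniq _)) => x _.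
Qed.

Lemma odd_count_mem (s : seq T) x : odd (count_mem x s) -> x \in s.
Proof. by move=> o; rewrite -has_pred1 has_count odd_gt0. Qed.

(** A letter repeated at alternate positions would leave at most four different letters, but odd
    multiplicities make every letter of [T] occur. *)
Lemma odd_word_uniq a (w : 5.-tuple T) :
  4 < #|T| -> w \in parity_words true a -> uniq (a :: w).
Proof.
rewrite inE => T4 /andP[/forallP H].
have {H} := fun x => eqP (H x).
have [b [c [d [e [f ->]]]]] := tuple5P w => H D.
have cov x := odd_count_mem (H x).
case/or3P: (parity_word_cases H D) =>
  [//|/andP[/eqP E1 /eqP E2]|/andP[/eqP E1 /eqP E2]].
- suff: #|T| <= 4 by rewrite leqNgt T4.
  apply: (@card_leq_cover [:: a; b; d; f]) => x.
  by move: (cov x); rewrite -E1 -E2 !inE; do 4!case: (x == _) => //.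
- suff: #|T| <= 4 by rewrite leqNgt T4.
  apply: (@card_leq_cover [:: a; b; c; e]) => x.
  by move: (cov x); rewrite -E1 -E2 !inE; do 4!case: (x == _) => //.
Qed.

Lemma uniq_cover (s : seq T) : uniq s -> size s = #|T| -> forall x, x \in s.
Proof.
move=> Us sz x; have /(_ _ _)[] := uniq_min_size Us (s2 := enum T).
- by move=> y _; rewrite mem_enum.
- by rewrite -cardE sz.
by move=> _ ->; rewrite mem_enum.
Qed.

(** A word without repetition that uses every letter needs exactly six letters, and then 5! = 120
    orderings start with [a]. *)
Lemma card_odd_words a : 4 < #|T| ->
  #|parity_words true a| = if #|T| == 6 then 120 else 0.
Proof.
move=> T4; case: eqP => [T6|nT6].
  have -> : 120 = #|T|.-1 ^_ 5 by rewrite T6.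
  rewrite -(card_uniq_cons 5 a); apply: eq_card => w.
  apply/idP/idP => [|]; first by rewrite [in X in _ -> X]inE; apply: odd_word_uniq.
  rewrite !inE => U; apply/andP; split.
    apply/forallP=> x; rewrite count_uniq_mem // uniq_cover //.
    by rewrite /= size_tuple T6.
  move: U; have [b [c [d [e [f ->]]]]] := tuple5P w.
  rewrite /= !inE [f == a]eq_sym.
  by do 15!case: (_ == _) => //.
apply: eq_card0 => w; apply/negP=> O; case: nT6; apply/eqP.
have := O; rewrite inE => /andP[/forallP H _].
rewrite eqn_leq; apply/andP; split.
  have := @card_leq_cover (a :: w); rewrite /= size_tuple; apply => x.
  by apply: odd_count_mem; rewrite (eqP (H x)).
by have /card_uniqP := odd_word_uniq T4 O; rewrite /= size_tuple => <-; apply: max_card.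
Qed.

(** The letter occurring three times is [a] itself or the letter [b] following it. *)
Definition odd_pattern a (k : bool) (t : 3.-tuple T) : 5.-tuple T :=
  let b := nth a t 0 in let c := nth a t 1 in let d := nth a t 2 in
  if k then [tuple b; a; c; a; d] else [tuple b; c; b; d; b].

Lemma uniq_of_cover (s : seq T) :
  (forall x, x \in s) -> size s <= #|T| -> uniq s.
Proof.
move=> cov sz; apply: (leq_size_uniq (enum_uniq T)) => [x _|].
  exact: cov.
by rewrite -cardE.
Qed.

(** The count is 2 * 3!: two patterns, and the orderings of the three letters other than [a]. *)
Lemma card_odd_words4 a : #|T| = 4 -> #|parity_words true a| = 12.
Proof.
move=> T4; have E := card_uniq_cons 3 a; rewrite T4 in E.
set S := [set t | _] in E.
transitivity #|setX [set: bool] S|; last first.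
  by rewrite cardsX cardsT card_bool E.
rewrite -(card_in_imset (f := fun u => odd_pattern a u.1 u.2)).
  apply: eq_card => w; rewrite inE; apply/andP/imsetP => [[/forallP H]|].
    have {H} := fun x => eqP (H x); have [b [c [d [e [f ->]]]]] := tuple5P w.
    move=> H D; have cov x := odd_count_mem (H x).
    have mk k x y z : (forall u, u \in [:: a; x; y; z]) ->
        (k, [tuple x; y; z]) \in setX [set: bool] S.
      by move=> ?; rewrite in_setX inE inE; apply: uniq_of_cover; rewrite ?T4.
    case/or3P: (parity_word_cases H D) =>
      [/card_uniqP U|/andP[/eqP E1 /eqP E2]|/andP[/eqP E1 /eqP E2]].
    - by have := max_card (mem [:: a; b; c; d; e; f]); rewrite U T4.
    - exists (true, [tuple b; d; f]); last by rewrite -E1 -E2; apply: val_inj.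
      by apply: mk => x; move: (cov x); rewrite -E1 -E2 !inE; do 4!case: (x == _) => //.
    - exists (false, [tuple b; c; e]); last by rewrite -E1 -E2; apply: val_inj.
      by apply: mk => x; move: (cov x); rewrite -E1 -E2 !inE; do 4!case: (x == _) => //.
  case=> [[k [[|b [|c [|d []]]] //= t3]]]; rewrite !inE => U ->.
  (* Each letter occurs once among [a], [b], [c], [d]; the pattern adds two more copies of [a] or of
     [b], which keeps the parities odd. *)
  have cnt x : count_mem x [:: a; b; c; d] = true.
    by rewrite count_uniq_mem // uniq_cover // T4.
  move: U; rewrite /= !inE !negb_or !andbT.
  move=> /and3P[/and3P[ab ac ad] /andP[bc bd] cd]; split; last first.
    case: k; rewrite /odd_pattern /=;
    by rewrite ?[b == a]eq_sym ?[c == a]eq_sym ?[d == a]eq_sym ?[c == b]eq_sym ?[d == b]eq_sym ab ?ac ?ad ?bc ?bd.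
  apply/forallP=> x; have := cnt x; case: k; rewrite /odd_pattern /=;
  by case: (a == x); case: (b == x); case: (c == x); case: (d == x).
move=> [k [[|b [|c [|d []]]] //= t3]] [l [[|b' [|c' [|d' []]]] //= t3']].
rewrite !inE /= !inE !negb_or !andbT.
move=> /and3P[/and3P[ab ac ad] /andP[bc bd] cd] /and3P[/and3P[ab' ac' ad'] /andP[bc' bd'] cd'].
case: k l => [] []; rewrite /odd_pattern /= => -[] *; clear E S; subst;
  first [by congr (_, _); apply: val_inj
        | by move: ab ac ad bc bd cd ab' ac' ad' bc' bd' cd'; rewrite ?eqxx ?andbF].
Qed.
End CountingWords.

(** * Cycle regularity of the folded cubes *)

Lemma card_good_words (m : nat) (a : option 'I_m) :
  #|good_words a| = #|parity_words true a| + #|parity_words false a|.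
Proof.
have parityE p (w : seq (option 'I_m)) :
    same_parity w && (odd (count_mem None w) == p)
      = [forall x, odd (count_mem x w) == p].
  apply/andP/forallP => [[/forallP E /eqP o] x|E]; first by rewrite (eqP (E x)) o.
  by split=> //; apply/forallP=> x; rewrite (eqP (E x)) (eqP (E None)).
(* [None] carries the common parity, so its multiplicity separates the two kinds of words. *)
rewrite -(cardsID [set w : 5.-tuple _ | odd (count_mem None (a :: w))]).
congr (_ + _); apply: eq_card => w; rewrite ?in_setI ?in_setD ![w \in finset _]inE -parityE.
  by rewrite eqb_id andbAC.
by rewrite eqbF_neg andbC andbAC.
Qed.

Lemma FQ_hexagon_regular (m k : nat) :
    3 <= m -> (forall a : option 'I_m, #|parity_words true a| = k) ->
  cycle_regular (FQ m.+1) 1 (k + 4 * (m * m.-1)) 6.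
Proof.
move=> m3 odd_k [[|x [|y []]] //= s2] /andP[_ /andP[xy _]].
rewrite (@card_cycles_through_edge (FQ m.+1) 3 x y).
have [a ->] := elimT (@FQ_adjP m x y (ltnW m3)) xy.
rewrite card_hexagons // card_good_words odd_k card_even_words.
by rewrite card_option card_ord.
Qed.

(** This settles the first three folded cubes: they have at most four vertices, too few for a
    hexagon. *)
Lemma cycle_regular_small (G : sgraph) (l m : nat) :
  #|G| < m -> cycle_regular G l 0 m.
Proof.
move=> Gm s _; apply: eq_card0 => C; rewrite inE.
apply/negP=> /andP[/andP[_ /existsP[c /and3P[/card_uniqP Uc _ _]]] _].
by have := max_card (mem c); rewrite Uc size_tuple leqNgt Gm.
Qed.

Theorem theorem6 :
  [/\ [/\ cycle_regular (FQ 1) 1 0 6,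
          cycle_regular (FQ 2) 1 0 6
        & cycle_regular (FQ 3) 1 0 6],
      cycle_regular (FQ 4) 1 36 6,
      cycle_regular (FQ 6) 1 200 6
    & forall n : nat, 1 <= n -> n \notin [:: 1; 2; 3; 4; 6] ->
        cycle_regular (FQ n) 1 (4 * (n - 2) * (n - 1)) 6].
Proof.
split.
- by split; apply: cycle_regular_small; rewrite /= card_ffun card_bool card_ord.
(* 36 = 12 + 4 * 3 * 2 *)
- apply: (@FQ_hexagon_regular 3 12) => // a.
  by apply: card_odd_words4; rewrite card_option card_ord.
(* 200 = 120 + 4 * 5 * 4 *)
- apply: (@FQ_hexagon_regular 5 120) => // a.
  by rewrite card_odd_words card_option card_ord.
case=> [|[|[|[|[|m]]]]] // _ nm.
have -> : 4 * (m.+4.+1 - 2) * (m.+4.+1 - 1) = 0 + 4 * (m.+4 * m.+3).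
  by rewrite !subSS !subn0 -mulnA [m.+3 * _]mulnC.
apply: FQ_hexagon_regular => // a.
(* The alphabet has as many letters as the index of the cube, which is not 6, so no odd word
   exists. *)
rewrite card_odd_words card_option card_ord // ifN //.
by apply: contra nm => /eqP [->].
Qed.
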